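(* Let $\mathcal{A}:\mathbb{R}^{m\times n}\to\mathbb{R}^k$ be a linear operator with adjoint $\mathcal{A}^*$, let $\mathbf{b}\in\mathbb{R}^k$, $\mu>0$, let $r$ be a positive integer and $0\le\delta_r<1$, and assume that $$(1-\delta_r)\|X\|_F^2\le\|\mathcal{A}X\|^2\le(1+\delta_r)\|X\|_F^2\quad\text{for all }X\in\mathbb{R}^{m\times n}\text{ with }\mathrm{rank}(X)\le r.$$ Let $F(X)=r_\mu(\boldsymbol{\sigma}(X))+\|\mathcal{A}X-\mathbf{b}\|^2$. Assume that $X_s$ is a stationary point of $F$, that is, $Z:=(I-\mathcal{A}^*\mathcal{A})X_s+\mathcal{A}^*\mathbf{b}$ satisfies $2Z\in\partial G(X_s)$, and that the singular values of $Z$ fulfill $$\sigma_i(Z)\notin\left[(1-\delta_r)\sqrt{\mu},\ \frac{\sqrt{\mu}}{1-\delta_r}\right]\quad\text{for all } i.$$ If $X_s'\neq X_s$ is another stationary point of $F$, then $\mathrm{rank}(X_s'-X_s)>r$.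
   Context: $\boldsymbol{\sigma}(X)$ is the vector of the $\min(m,n)$ singular values $\sigma_i(X)$ of $X$ (in non-increasing order); $\|\cdot\|_F$ is the Frobenius norm and $\|\cdot\|$ the Euclidean norm; the scalar product on matrices is $\langle X,Y\rangle=\mathrm{tr}(X^TY)$; $I$ is the identity operator on $\mathbb{R}^{m\times n}$. For a real vector $\mathbf{x}$, $r_\mu(\mathbf{x})=\sum_i\left(\mu-\max(\sqrt{\mu}-|x_i|,0)^2\right)$. $G(X)=r_\mu(\boldsymbol{\sigma}(X))+\|X\|_F^2=\sum_i g(\sigma_i(X))$, where $g(x)=\mu+x^2$ for $|x|\ge\sqrt{\mu}$ and $g(x)=2\sqrt{\mu}|x|$ for $|x|\le\sqrt{\mu}$. $G$ is convex and $\partial G$ denotes its convex sub-differential. Explicitly, $W\in\partial G(X)$ if and only if there is a singular value decomposition $X=UD_{\boldsymbol{\sigma}(X)}V^T$ ($U\in\mathbb{R}^{m\times m}$, $V\in\mathbb{R}^{n\times n}$ orthogonal, $D_{\mathbf{w}}$ the $m\times n$ rectangular diagonal matrix with diagonal $\mathbf{w}$) such that $W=UD_{\mathbf{w}}V^T$ with $w_i\in\partial g(\sigma_i(X))$ for all $i$; here $\partial g(x)=\{2x\}$ if $|x|\ge\sqrt{\mu}$, $\partial g(x)=\{2\sqrt{\mu}\,\mathrm{sign}(x)\}$ if $0<|x|\le\sqrt{\mu}$, and $\partial g(0)=[-2\sqrt{\mu},2\sqrt{\mu}]$. A matrix $X$ is called a stationary point of $F$ if $2(I-\mathcal{A}^*\mathcal{A})X+2\mathcal{A}^*\mathbf{b}\in\partial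 G(X)$. *)

(* Defs.v *)
From HB Require Import structures.
From mathcomp Require Import all_boot all_order all_algebra.
From mathcomp Require Import classical_sets reals.

Set Implicit Arguments.
Unset Strict Implicit.
Unset Printing Implicit Defensive.

Import Order.TTheory GRing.Theory Num.Theory.
Local Open Scope classical_set_scope.
Local Open Scope ring_scope.

Section Matrices.
Variables (R : realType).

(* On column vectors these two are the Euclidean scalar product and norm. *)
Definition mxdot m n (X Y : 'M[R]_(m, n)) : R := \tr (X^T *m Y).

Definition frob m n (X : 'M[R]_(m, n)) : R := Num.sqrt (mxdot X X).

Definition orthogonal n (U : 'M[R]_n) : Prop := U^T *m U = 1%:M.

Definition rect_diag m n (w : 'rV[R]_(minn m n)) : 'M[R]_(m, n) :=
  \matrix_(i, j) \sum_(l < minn m n | (l == i :> nat) && (l == j :> nat)) w 0 l.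

Definition is_singular_values m n (X : 'M[R]_(m, n)) (s : 'rV[R]_(minn m n))
    : Prop :=
  [/\ forall i, 0 <= s 0 i,
      forall i j : 'I_(minn m n), (i <= j)%N -> s 0 j <= s 0 i
    & exists (U : 'M[R]_m) (V : 'M[R]_n),
        [/\ orthogonal U, orthogonal V & X = U *m rect_diag s *m V^T]].

(* Every real matrix has exactly one vector satisfying [is_singular_values X],
   so the default value 0 is never taken. *)
Definition singular_values m n (X : 'M[R]_(m, n)) : 'rV[R]_(minn m n) :=
  xget 0 [set s | is_singular_values X s].

Definition subdifferential m n (f : 'M[R]_(m, n) -> R) (X : 'M[R]_(m, n))
    : set 'M[R]_(m, n) :=
  [set W | forall Y, f X + mxdot W (Y - X) <= f Y].

Lemma mxdotE m n (X Y : 'M[R]_(m, n)) :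
  mxdot X Y = \sum_i \sum_j X i j * Y i j.
Proof.
rewrite /mxdot /mxtrace exchange_big /=; apply: eq_bigr => j _.
by rewrite mxE; apply: eq_bigr => i _; rewrite mxE.
Qed.

Lemma sqr_frob m n (X : 'M[R]_(m, n)) : frob X ^+ 2 = mxdot X X.
Proof.
rewrite sqr_sqrtr // mxdotE.
by do 2![apply: sumr_ge0 => ? _]; rewrite -expr2 sqr_ge0.
Qed.

Definition adjoint m n k (A : {linear 'M[R]_(m, n) -> 'cV[R]_k}) (y : 'cV[R]_k)
    : 'M[R]_(m, n) :=
  \matrix_(i, j) mxdot (A (delta_mx i j)) y.

Lemma adjointP m n k (A : {linear 'M[R]_(m, n) -> 'cV[R]_k})
    (X : 'M[R]_(m, n)) (y : 'cV[R]_k) :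
  mxdot (A X) y = mxdot X (adjoint A y).
Proof.
rewrite mxdotE {1}[X]matrix_sum_delta linear_sum /=.
under eq_bigr => a _ do under eq_bigr => b _ do
  rewrite summxE mulr_suml.
rewrite [RHS]mxdotE.
under eq_bigr => a _ do rewrite exchange_big /=.
rewrite exchange_big /=; apply: eq_bigr => i _.
under eq_bigr => a _ do under eq_bigr => b _ do
  rewrite linear_sum summxE mulr_suml.
under eq_bigr => a _ do rewrite exchange_big /=.
rewrite exchange_big /=; apply: eq_bigr => j _.
rewrite mxE mxdotE mulr_sumr; apply: eq_bigr => a _.
rewrite mulr_sumr; apply: eq_bigr => b _.
by rewrite linearZ mxE mulrA.
Qed.

End Matrices.

Section Objective.
Variables (R : realType).

Definition r_mu (mu : R) p (x : 'rV[R]_p) : R :=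
  \sum_i (mu - Num.max (Num.sqrt mu - `|x 0 i|) 0 ^+ 2).

Definition objF m n k (A : {linear 'M[R]_(m, n) -> 'cV[R]_k}) (b : 'cV[R]_k)
    (mu : R) (X : 'M[R]_(m, n)) : R :=
  r_mu mu (singular_values X) + frob (A X - b) ^+ 2.

Definition regG (mu : R) m n (X : 'M[R]_(m, n)) : R :=
  r_mu mu (singular_values X) + frob X ^+ 2.

Lemma objFE m n k (A : {linear 'M[R]_(m, n) -> 'cV[R]_k}) b mu X :
  objF A b mu X = regG mu X - (frob X ^+ 2 - frob (A X - b) ^+ 2).
Proof. by rewrite /objF /regG opprB [_ - frob X ^+ 2]addrC addrA addrK. Qed.

Definition statZ m n k (A : {linear 'M[R]_(m, n) -> 'cV[R]_k}) (b : 'cV[R]_k)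
    (X : 'M[R]_(m, n)) : 'M[R]_(m, n) :=
  X - adjoint A (A X) + adjoint A b.

(* Stationarity of [objF A b mu]: by [objFE] it is the convex function [regG mu]
   minus a smooth function whose gradient at X is [2 *: statZ A b X]. *)
Definition stationary m n k (A : {linear 'M[R]_(m, n) -> 'cV[R]_k})
    (b : 'cV[R]_k) (mu : R) (X : 'M[R]_(m, n)) : Prop :=
  subdifferential (@regG mu m n) X (2 *: statZ A b X).

Definition rank_RIP m n k (A : {linear 'M[R]_(m, n) -> 'cV[R]_k}) (r : nat)
    (delta : R) : Prop :=
  forall X : 'M[R]_(m, n), (\rank X <= r)%N ->
    (1 - delta) * frob X ^+ 2 <= frob (A X) ^+ 2 <= (1 + delta) * frob X ^+ 2.

End Objective.

(* Main.v *)
(** For [Z = statZ A b X] one has [Z' - Z = H - A^* A H] with [H = X' - X], so if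
    [rank H <= r] the isometry property gives
    [<Z' - Z, H> = |H|^2 - |A H|^2 <= delta |H|^2].  In the other direction, the
    gap hypothesis still holds for some [d > delta], and it implies
    [d |H|^2 <= <Z' - Z, H>]; hence [H = 0].

    The last inequality holds for scalars by a case analysis on the graph of the
    subdifferential of [g].  It passes to matrices because each stationary [X]
    shares its singular vectors with [Z], and the scalar product of
    [U diag(a) V^T] and [P diag(b) Q^T] is [sum_ij c_ij a_i b_j] where [|c|] is
    doubly substochastic: an inequality [0 <= w_ij <= al_i + be_j] with
    [al, be >= 0] can then be summed against [c].  The same transport argument
    shows that [X] and [Z] share their singular vectors, without appealing to
    the equality case of von Neumann's trace inequality. *)
From mathcomp Require Import all_boot all_order all_algebra.
From mathcomp Require Import boolp classical_sets reals.
From mathcomp Require Import topology normedtype derive.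
From mathcomp Require Import ring lra.
Require Import Defs.

Set Implicit Arguments.
Unset Strict Implicit.
Unset Printing Implicit Defensive.

Import Order.TTheory GRing.Theory Num.Theory.
Import numFieldNormedType.Exports.
Local Open Scope classical_set_scope.
Local Open Scope ring_scope.

(** * The trace scalar product on matrices *)

Section ScalarProduct.
Variable R : realType.

Lemma mxdotC m n (X Y : 'M[R]_(m, n)) : mxdot X Y = mxdot Y X.
Proof. by rewrite /mxdot -mxtrace_tr trmx_mul trmxK. Qed.

Lemma mxdotDr m n (X Y Z : 'M[R]_(m, n)) :
  mxdot X (Y + Z) = mxdot X Y + mxdot X Z.
Proof. by rewrite /mxdot mulmxDr mxtraceD. Qed.

Lemma mxdotNr m n (X Y : 'M[R]_(m, n)) : mxdot X (- Y) = - mxdot X Y.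
Proof. by rewrite /mxdot mulmxN raddfN. Qed.

Lemma mxdotBr m n (X Y Z : 'M[R]_(m, n)) :
  mxdot X (Y - Z) = mxdot X Y - mxdot X Z.
Proof. by rewrite mxdotDr mxdotNr. Qed.

Lemma mxdotZr m n a (X Y : 'M[R]_(m, n)) : mxdot X (a *: Y) = a * mxdot X Y.
Proof. by rewrite /mxdot -scalemxAr mxtraceZ. Qed.

Lemma mxdotDl m n (X Y Z : 'M[R]_(m, n)) :
  mxdot (Y + Z) X = mxdot Y X + mxdot Z X.
Proof. by rewrite !(mxdotC _ X) mxdotDr. Qed.

Lemma mxdotNl m n (X Y : 'M[R]_(m, n)) : mxdot (- Y) X = - mxdot Y X.
Proof. by rewrite !(mxdotC _ X) mxdotNr. Qed.

Lemma mxdotBl m n (X Y Z : 'M[R]_(m, n)) :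
  mxdot (Y - Z) X = mxdot Y X - mxdot Z X.
Proof. by rewrite mxdotDl mxdotNl. Qed.

Lemma mxdotZl m n a (X Y : 'M[R]_(m, n)) : mxdot (a *: Y) X = a * mxdot Y X.
Proof. by rewrite !(mxdotC _ X) mxdotZr. Qed.

Lemma mxdot_suml m n (I : Type) (r : seq I) (F : I -> 'M[R]_(m, n)) X :
  mxdot (\sum_(i <- r) F i) X = \sum_(i <- r) mxdot (F i) X.
Proof. by rewrite /mxdot raddf_sum mulmx_suml raddf_sum. Qed.

Lemma mxdot_ge0 m n (X : 'M[R]_(m, n)) : 0 <= mxdot X X.
Proof. by rewrite -sqr_frob sqr_ge0. Qed.

Lemma mxdot_eq0 m n (X : 'M[R]_(m, n)) : mxdot X X = 0 -> X = 0.
Proof.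
rewrite mxdotE => /psumr_eq0P X0; apply/matrixP => i j; rewrite mxE.
have /psumr_eq0P X0i : \sum_j X i j * X i j = 0.
  by apply: X0 => // l _; apply: sumr_ge0 => ? _; rewrite -expr2 sqr_ge0.
apply/eqP; rewrite -sqrf_eq0 expr2; apply/eqP/X0i => // l _.
by rewrite -expr2 sqr_ge0.
Qed.

Lemma mxdot_mull m n p (A : 'M[R]_(m, p)) (X : 'M[R]_(p, n)) Y :
  mxdot (A *m X) Y = mxdot X (A^T *m Y).
Proof. by rewrite /mxdot trmx_mul mulmxA. Qed.

Lemma mxdot_mulr m n p (B : 'M[R]_(p, n)) (X : 'M[R]_(m, p)) Y :
  mxdot (X *m B) Y = mxdot X (Y *m B^T).
Proof. by rewrite /mxdot trmx_mul -mulmxA mxtrace_mulC mulmxA. Qed.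

Lemma mxdot_delta m n i j (X : 'M[R]_(m, n)) : mxdot (delta_mx i j) X = X i j.
Proof.
rewrite mxdotE (bigD1 i) //= (bigD1 j) //= mxE !eqxx mul1r.
rewrite big1 => [|l lj]; last by rewrite mxE (negPf lj) andbF mul0r.
rewrite big1 => [|k ki]; first by rewrite !addr0.
by rewrite big1 // => l _; rewrite mxE (negPf ki) mul0r.
Qed.

Lemma mxdot_col n (u v : 'cV[R]_n) : u^T *m v = (mxdot u v)%:M.
Proof. by rewrite [LHS]mx11_scalar /mxdot /mxtrace big_ord1. Qed.

End ScalarProduct.

(** * Orthogonal matrices and reflections *)

Section Orthogonal.
Variable R : realType.

Lemma orthogonalC n (U : 'M[R]_n) : orthogonal U -> U *m U^T = 1%:M.
Proof. exact: mulmx1C. Qed.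

Lemma orthogonal_tr n (U : 'M[R]_n) : orthogonal U -> orthogonal U^T.
Proof. by move=> oU; rewrite /orthogonal trmxK orthogonalC. Qed.

Lemma orthogonal1 n : orthogonal (1%:M : 'M[R]_n).
Proof. by rewrite /orthogonal trmx1 mulmx1. Qed.

Lemma orthogonalM n (U V : 'M[R]_n) :
  orthogonal U -> orthogonal V -> orthogonal (U *m V).
Proof.
by move=> oU oV; rewrite /orthogonal trmx_mul mulmxA -(mulmxA V^T) oU mulmx1.
Qed.

Lemma orthogonal_mxdot n p (U : 'M[R]_n) (X Y : 'M[R]_(n, p)) :
  orthogonal U -> mxdot (U *m X) (U *m Y) = mxdot X Y.
Proof. by move=> oU; rewrite mxdot_mull mulmxA oU mul1mx. Qed.

(* The Householder reflection exchanging [u] and the first basis vector. *)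
Lemma orthogonal_first_col n (u : 'cV[R]_n.+1) :
  mxdot u u = 1 ->
  exists2 U : 'M[R]_n.+1, orthogonal U & U *m delta_mx 0 0 = u.
Proof.
move=> u1; set e := delta_mx 0 0; pose w := u - e.
have e1 : mxdot e e = 1 by rewrite mxdot_delta mxE !eqxx.
have [w0|w0] := eqVneq (mxdot w w) 0.
  exists 1%:M; first exact: orthogonal1.
  by rewrite mul1mx; apply/esym/subr0_eq/mxdot_eq0.
have wwE : mxdot w w = 2 * (1 - mxdot u e).
  by rewrite mxdotBl !mxdotBr u1 e1 (mxdotC e u); ring.
pose U : 'M[R]_n.+1 := 1%:M - (2 / mxdot w w) *: (w *m w^T).
have UT : U^T = U by rewrite /U linearB linearZ /= trmx_mul trmxK trmx1.
exists U.
  rewrite /orthogonal UT {2}/U mulmxBr mulmx1 -scalemxAr mulmxA.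
  (* A reflection negates its axis [w], so it is an involution; being also symmetric, it is
     orthogonal. *)
  have -> : U *m w = - w.
    rewrite /U mulmxBl mul1mx -scalemxAl -mulmxA mxdot_col mul_mx_scalar.
    by rewrite scalerA divfK // scaler_nat mulr2n opprD addNKr.
  by rewrite mulNmx scalerN opprK subrK.
rewrite /U mulmxBl mul1mx -scalemxAl -mulmxA mxdot_col mul_mx_scalar scalerA.
have -> : mxdot w e = mxdot u e - 1 by rewrite mxdotBl e1.
have {w0 wwE} -> : 2 / mxdot w w * (mxdot u e - 1) = -1.
  move: w0; rewrite wwE => w0; field.
  by apply: contra w0 => /eqP ->; rewrite mulr0.
by rewrite scaleN1r opprK addrC subrK.
Qed.

End Orthogonal.

(** * Existence of the singular value decomposition *)

Section SVD.
Variable R : realType.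

Lemma continuous_sum (T : topologicalType) n (F : 'I_n -> T -> R) :
  (forall i, continuous (F i)) -> continuous (fun x => \sum_i F i x).
Proof.
by move=> Fc; apply: continuous_big => [|i _]; [exact: add_continuous | exact: Fc].
Qed.

Lemma unit_sphere_compact n : compact [set v : 'rV[R]_n | mxdot v v = 1].
Proof.
apply: bounded_closed_compact.
  exists 1; split => // M M1 v /= v1; rewrite [leLHS]/Num.norm /= mx_normrE.
  apply: bigmax_le => [|[i j] _ /=]; first by apply: ltW; apply: lt_trans M1.
  rewrite ord1 {i}; apply: le_trans (ltW M1); rewrite -(@expr_le1 _ 2) //.
  rewrite real_normK ?num_real // -v1 mxdotE big_ord1 (bigD1 j) //= expr2.
  by rewrite lerDl; apply: sumr_ge0 => l _; rewrite -expr2 sqr_ge0.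
have -> : [set v : 'rV[R]_n | mxdot v v = 1]
        = (fun v : 'rV[R]_n => mxdot v v) @^-1` [set 1] by [].
apply: preimage_closed; last exact: closed_eq.
move=> v _; move: v; rewrite -/(continuous _).
rewrite (_ : (fun v => _) = fun v : 'rV[R]_n => \sum_j v 0 j * v 0 j).
  by apply: continuous_sum => j v; apply: continuousM; exact: coord_continuous.
by apply/funext => w; rewrite mxdotE big_ord1.
Qed.

Lemma continuous_mxdot_mul m n (X : 'M[R]_(n, m)) :
  continuous (fun v : 'rV[R]_n => mxdot (v *m X) (v *m X)).
Proof.
rewrite (_ : (fun v => _) = fun v : 'rV[R]_n =>
    \sum_j (\sum_i v 0 i * X i j) * (\sum_i v 0 i * X i j)).
  have Xc j : continuous (fun v : 'rV[R]_n => \sum_i v 0 i * X i j).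
    apply: continuous_sum => i v.
    by apply: continuousM; [exact: coord_continuous | exact: cst_continuous].
  by apply: continuous_sum => j v; apply: continuousM; exact: Xc.
apply/funext => w; rewrite mxdotE big_ord1.
by apply: eq_bigr => j _; rewrite mxE.
Qed.

(** First-order optimality in one variable: [t = - a / (c + 1)] gives the value
    [- a ^+ 2 * (c + 2) / (c + 1) ^+ 2], where [c >= 0]. *)
Lemma tangent_eq0 (a c : R) :
  (forall t, 0 <= 2 * t * a + t ^+ 2 * c) -> a = 0.
Proof.
move=> tang; have c0 : 0 <= c by have := tang 1; have := tang (-1); lra.
have := tang (- a / (c + 1)).
have -> : 2 * (- a / (c + 1)) * a + (- a / (c + 1)) ^+ 2 * c
        = - (a ^+ 2 * ((c + 2) / (c + 1) ^+ 2)) by field; lra.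
rewrite oppr_ge0 pmulr_lle0; last by apply: divr_gt0; [lra | apply: exprn_gt0; lra].
by rewrite le_eqVlt ltNge sqr_ge0 orbF sqrf_eq0 => /eqP.
Qed.

(* A maximiser [v] of [|X v|^2] on the sphere is an eigenvector of [X^T X]
   because the nonnegative form [s2 |w|^2 - |X w|^2] vanishes at [v]. *)
Lemma top_eigenvector m n (X : 'M[R]_(m, n.+1)) :
  exists s2 (v : 'cV[R]_n.+1),
    [/\ mxdot v v = 1, X^T *m (X *m v) = s2 *: v
      & forall w : 'cV[R]_n.+1, mxdot (X *m w) (X *m w) <= s2 * mxdot w w].
Proof.
pose S := [set v : 'rV[R]_n.+1 | mxdot v v = 1].
pose f (v : 'rV[R]_n.+1) := mxdot (v *m X^T) (v *m X^T).
have S0 : S !=set0.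
  by exists (delta_mx 0 0); rewrite /S /= mxdot_delta mxE !eqxx.
have [|v] := EVT_max_rV (f := f) S0 (@unit_sphere_compact _).
  by apply: continuous_subspaceT; exact: continuous_mxdot_mul.
rewrite inE /S /= => v1 vmax.
have fE (w : 'cV[R]_n.+1) : f w^T = mxdot (X *m w) (X *m w).
  by rewrite /f -trmx_mul /mxdot mxtrace_mulC trmxK.
have mxdotT (w : 'cV[R]_n.+1) : mxdot w^T w^T = mxdot w w.
  by rewrite /mxdot mxtrace_mulC trmxK.
exists (f v), v^T.
have max (w : 'cV[R]_n.+1) : mxdot (X *m w) (X *m w) <= f v * mxdot w w.
  have [w0|w0] := eqVneq (mxdot w w) 0.
    by rewrite w0 mulr0 (mxdot_eq0 w0) mulmx0 /mxdot mulmx0 mxtrace0.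
  have ww : 0 < mxdot w w by rewrite lt_def w0 mxdot_ge0.
  (* By homogeneity the bound on the unit sphere extends to every nonzero [w]. *)
  have := vmax ((Num.sqrt (mxdot w w))^-1 *: w^T).
  rewrite inE /= -linearZ /= fE mxdotT -scalemxAr !mxdotZl !mxdotZr !mulrA.
  rewrite -expr2 exprVn sqr_sqrtr ?(ltW ww) // mulVf // => /(_ erefl).
  by rewrite ler_pdivrMl // mulrC.
have vT1 : mxdot v^T v^T = 1 by rewrite -mxdotT trmxK.
split=> //.
apply/esym/subr0_eq/mxdot_eq0; set e := _ - _.
have eE : mxdot e e = f v * mxdot v^T e - mxdot (X *m v^T) (X *m e).
  by rewrite {1}/e mxdotBl mxdotZl (mxdot_mull X^T) trmxK.
clearbody e.
(* Along [v + t e] the nonnegative form has no constant term, and its linear coefficient is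
   [2 <e, e>] by [eE]. *)
apply: (@tangent_eq0 _ (f v * mxdot e e - mxdot (X *m e) (X *m e))) => t.
have := max (v^T + t *: e); rewrite mulmxDr -scalemxAr.
rewrite !(mxdotDl, mxdotDr, mxdotZl, mxdotZr) -!fE trmxK.
rewrite (mxdotC e v^T) (mxdotC (X *m e) (X *m v^T)).
by rewrite vT1 eE; lra.
Qed.

Lemma top_singular m n (X : 'M[R]_(m.+1, n.+1)) :
  exists s (u : 'cV[R]_m.+1) (v : 'cV[R]_n.+1),
    [/\ 0 <= s, mxdot u u = 1 /\ mxdot v v = 1,
        X *m v = s *: u, X^T *m u = s *: v
      & forall w : 'cV[R]_n.+1, mxdot (X *m w) (X *m w) <= s ^+ 2 * mxdot w w].
Proof.
have [s2 [v [v1 XXv max]]] := top_eigenvector X.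
have s2E : mxdot (X *m v) (X *m v) = s2.
  by rewrite mxdot_mull XXv mxdotZr v1 mulr1.
have s2_ge0 : 0 <= s2 by rewrite -s2E mxdot_ge0.
have [s20|s2_neq0] := eqVneq s2 0.
  (* Here [X = 0], and any unit vector can serve as [u]. *)
  have X0 (w : 'cV[R]_n.+1) : X *m w = 0.
    apply: mxdot_eq0; apply/eqP; rewrite eq_le mxdot_ge0 andbT.
    by have := max w; rewrite s20 mul0r.
  have {}X0 : X = 0.
    apply/matrixP => i j; have := X0 (delta_mx j 0).
    by rewrite -colE => /matrixP/(_ i 0); rewrite !mxE.
  exists 0, (delta_mx 0 0), v; rewrite X0 trmx0 !mul0mx !scale0r; split=> //.
    by split=> //; rewrite mxdot_delta mxE !eqxx.
  by move=> w; rewrite !mul0mx /mxdot mulmx0 mxtrace0 expr0n mul0r.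
have s_neq0 : Num.sqrt s2 != 0 by rewrite sqrtr_eq0 -ltNge lt_def s2_neq0.
exists (Num.sqrt s2), ((Num.sqrt s2)^-1 *: (X *m v)), v; split=> //.
- exact: sqrtr_ge0.
- by split=> //; rewrite mxdotZl mxdotZr s2E mulrA -expr2 exprVn sqr_sqrtr // mulVf.
- by rewrite scalerA mulfV // scale1r.
- rewrite -scalemxAr XXv scalerA -[s2 in _ * s2]sqr_sqrtr // expr2 mulrA.
  by rewrite mulVf // mul1r.
- by move=> w; rewrite sqr_sqrtr.
Qed.

(** Indexing the values by [nat] lets the induction on both dimensions shift them without casts
    through [minn m n]. *)
Definition svals_mx m n (s : nat -> R) : 'M[R]_(m, n) :=
  \matrix_(i, j) (s i *+ (i == j :> nat)).

Lemma svals_mx_block m n s :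
  svals_mx m.+1 n.+1 s =
  block_mx (s 0)%:M 0 0 (svals_mx m n (fun i => s i.+1)) :> 'M_(1 + m, 1 + n).
Proof.
apply/matrixP => i j; rewrite !mxE.
case: splitP => [i' ->|i' ->]; rewrite !mxE; case: splitP => j' ->; rewrite !mxE.
- by rewrite !ord1.
- by rewrite ord1.
- by rewrite ord1.
- by rewrite eqSS.
Qed.

Lemma orthogonal_block n (U : 'M[R]_n) :
  orthogonal U -> orthogonal (block_mx 1%:M 0 0 U : 'M_(1 + n)).
Proof.
move=> oU; rewrite /orthogonal tr_block_mx mulmx_block !trmx0 trmx1.
by rewrite !mulmx0 !mul0mx mulmx1 oU !addr0 add0r -scalar_mx_block.
Qed.

(* The last clause (the top value is at most any operator-norm bound) only
   serves to keep the values sorted along the induction. *)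
Lemma svd_exists m n (X : 'M[R]_(m, n)) :
  exists (s : nat -> R) (U : 'M[R]_m) (V : 'M[R]_n),
    [/\ orthogonal U, orthogonal V, X = U *m svals_mx m n s *m V^T,
        forall i, 0 <= s i.+1 <= s i
      & forall c : R, 0 <= c ->
          (forall w : 'cV[R]_n, mxdot (X *m w) (X *m w) <= c ^+ 2 * mxdot w w) ->
          s 0 <= c].
Proof.
elim: m n X => [|m IHm] [|n] X.
1-3: exists (fun=> 0), 1%:M, 1%:M; split=> //; do ?exact: orthogonal1.
- by rewrite [RHS]flatmx0 flatmx0.
- by move=> ?; rewrite lexx.
- by rewrite [RHS]flatmx0 flatmx0.
- by move=> ?; rewrite lexx.
- by rewrite [RHS]thinmx0 thinmx0.
- by move=> ?; rewrite lexx.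
have [s [u [v [s_ge0 [u1 v1] Xv Xu max]]]] := top_singular X.
have [U1 oU1 U1u] := orthogonal_first_col u1.
have [V1 oV1 V1v] := orthogonal_first_col v1.
(* In orthonormal bases starting with [u] and [v] the matrix is block diagonal: [Y0] clears the
   first column and [YT0] the first row. *)
pose Y : 'M_(m.+1, n.+1) := U1^T *m X *m V1.
have Y0 : Y *m delta_mx 0 0 = s *: delta_mx 0 0 :> 'cV_m.+1.
  by rewrite /Y -!mulmxA V1v Xv -scalemxAr -U1u mulmxA oU1 mul1mx.
have YT0 : Y^T *m delta_mx 0 0 = s *: delta_mx 0 0 :> 'cV_n.+1.
  rewrite /Y !trmx_mul trmxK -!mulmxA U1u Xu -scalemxAr -V1v.
  by rewrite mulmxA oV1 mul1mx.
have XE : X = U1 *m Y *m V1^T.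
  rewrite /Y !mulmxA orthogonalC // mul1mx -mulmxA orthogonalC //.
  by rewrite mulmx1.
clearbody Y; pose X' := drsubmx (Y : 'M_(1 + m, 1 + n)).
have YE : Y = (block_mx (s%:M : 'M_1) 0 0 X' : 'M_(1 + m, 1 + n)).
  rewrite -[LHS](@submxK _ 1 m 1 n).
  have -> : @ulsubmx _ 1 m 1 n Y = s%:M.
    apply/matrixP => i j; have /matrixP/(_ 0 0) := Y0.
    rewrite -colE !mxE !ord1 !eqxx mulr1 => <-.
    by congr (fun_of_matrix _ _ _); apply: val_inj.
  have -> : @ursubmx _ 1 m 1 n Y = 0.
    apply/matrixP => i j; have /matrixP/(_ (rshift 1 j) 0) := YT0.
    rewrite -colE !mxE !ord1 mulr0 => <-.
    by congr (fun_of_matrix _ _ _); apply: val_inj.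
  have -> // : @dlsubmx _ 1 m 1 n Y = 0.
  apply/matrixP => i j; have /matrixP/(_ (rshift 1 i) 0) := Y0.
  rewrite -colE !mxE !ord1 mulr0 => <-.
  by congr (fun_of_matrix _ _ _); apply: val_inj.
have [s' [U' [V' [oU' oV' X'E s'P s'max]]]] := IHm n X'.
pose t i := if i is j.+1 then s' j else s.
pose U2 : 'M[R]_(1 + m) := block_mx 1%:M 0 0 U'.
pose V2 : 'M[R]_(1 + n) := block_mx 1%:M 0 0 V'.
have YE2 : Y = U2 *m svals_mx (1 + m) (1 + n) t *m V2^T.
  rewrite YE svals_mx_block /U2 /V2 tr_block_mx !mulmx_block !trmx0 trmx1.
  by rewrite !(mulmx0, mul0mx, mulmx1, mul1mx, addr0, add0r) {1}X'E.
exists t, (U1 *m U2), (V1 *m V2); split.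
- by apply: orthogonalM => //; exact: orthogonal_block.
- by apply: orthogonalM => //; exact: orthogonal_block.
- by rewrite XE YE2 trmx_mul !mulmxA.
- case=> [|i]; last exact: s'P.
  apply/andP; split; first by case/andP: (s'P 0%N) => s1 /(le_trans s1).
  (* Testing [X] at [V1 *m w0] shows that the block [X'] inherits the bound [s], so its top value is
     at most [s]. *)
  apply: s'max => // w; pose w0 : 'cV[R]_(1 + n) := col_mx 0 w.
  have col0_mxdot p (z : 'cV[R]_p) :
      mxdot (col_mx 0 z : 'cV_(1 + p)) (col_mx 0 z) = mxdot z z.
    by rewrite /mxdot tr_col_mx mul_row_col mulmx0 add0r.
  have Yw0 : Y *m w0 = (col_mx 0 (X' *m w) : 'cV_(1 + m)).
    have := mul_block_col (s%:M : 'M_1) 0 0 X' 0 w.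
    by rewrite !(mulmx0, mul0mx, addr0, add0r) -YE.
  have := max (V1 *m w0); rewrite (orthogonal_mxdot _ _ oV1) XE -!mulmxA.
  rewrite (mulmxA V1^T) oV1 mul1mx (orthogonal_mxdot _ _ oU1) Yw0.
  by rewrite !col0_mxdot.
(* The value [s] is attained at the unit vector [v], so every bound [c] is at least [s]. *)
- move=> c c0 /(_ v); rewrite Xv v1 mxdotZl mxdotZr u1 !mulr1 -expr2.
  by rewrite ler_pXn2r // nnegrE.
Qed.

End SVD.

(** * Coupling of two singular value decompositions *)

Section Coupling.
Variables (R : realType) (m n : nat).
Local Notation p := (minn m n).

Definition lord (l : 'I_p) : 'I_m := widen_ord (geq_minl m n) l.
Definition rord (l : 'I_p) : 'I_n := widen_ord (geq_minr m n) l.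

Lemma lord_inj : injective lord.
Proof. by move=> i j /(congr1 val) /= /val_inj. Qed.

Lemma rord_inj : injective rord.
Proof. by move=> i j /(congr1 val) /= /val_inj. Qed.

Lemma rect_diag_sum (a : 'rV[R]_p) :
  rect_diag a = \sum_l a 0 l *: delta_mx (lord l) (rord l) :> 'M_(m, n).
Proof.
apply/matrixP => i j; rewrite summxE mxE big_mkcond /=; apply: eq_bigr => l _.
rewrite !mxE -!val_eqE /= (eq_sym (i : nat)) (eq_sym (j : nat)).
by case: ifP => _; rewrite ?mulr1 ?mulr0.
Qed.

Lemma svals_mx_rect_diag (s : nat -> R) :
  svals_mx m n s = rect_diag (\row_(l < p) s l).
Proof.
apply/matrixP => i j; rewrite !mxE; have [ij|ij] := eqVneq (i : nat) j.
  have ip : (i < p)%N by rewrite ltn_min ltn_ord /= ij ltn_ord.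
  rewrite (bigD1 (Ordinal ip)) /= ?eqxx ?ij ?eqxx // mxE /= big1 ?addr0 -?ij //.
  move=> l /andP[/andP[/eqP li _]]; rewrite -val_eqE /= li ij.
  by rewrite eqxx.
by rewrite big1 // => l /andP[/eqP li /eqP lj]; rewrite -li lj eqxx in ij.
Qed.

Definition svd_mx (U : 'M[R]_m) (V : 'M[R]_n) (a : 'rV[R]_p) : 'M[R]_(m, n) :=
  U *m rect_diag a *m V^T.

Lemma svd_mxD U V (a b : 'rV[R]_p) :
  svd_mx U V (a + b) = svd_mx U V a + svd_mx U V b.
Proof.
rewrite /svd_mx -mulmxDl -mulmxDr; congr (_ *m _ *m _).
rewrite !rect_diag_sum -big_split /=; apply: eq_bigr => l _.
by rewrite !mxE scalerDl.
Qed.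

Lemma svd_mxZ U V c (a : 'rV[R]_p) : svd_mx U V (c *: a) = c *: svd_mx U V a.
Proof.
rewrite /svd_mx scalemxAl scalemxAr; congr (_ *m _ *m _).
rewrite !rect_diag_sum scaler_sumr; apply: eq_bigr => l _.
by rewrite !mxE scalerA.
Qed.

Lemma sum_inj_le q (f : 'I_p -> 'I_q) (F : 'I_q -> R) :
  injective f -> (forall k, 0 <= F k) -> \sum_l F (f l) <= \sum_k F k.
Proof.
move=> f_inj F0; rewrite [leRHS](bigID [pred k in f @: 'I_p]) /=.
rewrite big_imset /=; last exact: in2W.
by rewrite lerDl; apply: sumr_ge0.
Qed.

Lemma orthogonal_row_le1 q (W : 'M[R]_q) (f : 'I_p -> 'I_q) i :
  injective f -> orthogonal W -> \sum_l W i (f l) ^+ 2 <= 1.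
Proof.
move=> f_inj oW; have /matrixP/(_ i i) := orthogonalC oW.
rewrite !mxE eqxx mulr1n => <-.
under [leRHS]eq_bigr => k _ do rewrite mxE -expr2.
by apply: (sum_inj_le f_inj) => k; rewrite sqr_ge0.
Qed.

(** In terms of columns this is [<u_i, p_j> <v_i, q_j>], the scalar product of the rank-one matrices
    [u_i v_i^T] and [p_j q_j^T]. *)
Definition coupling (U P : 'M[R]_m) (V Q : 'M[R]_n) (i j : 'I_p) : R :=
  (U^T *m P) (lord i) (lord j) * (V^T *m Q) (rord i) (rord j).

Lemma mxdot_svd_mx U V P Q a b :
  mxdot (svd_mx U V a) (svd_mx P Q b) =
  \sum_i \sum_j coupling U P V Q i j * (a 0 i * b 0 j).
Proof.
rewrite /svd_mx mxdot_mulr mxdot_mull trmxK rect_diag_sum mxdot_suml.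
apply: eq_bigr => i _; rewrite mxdotZl mxdot_delta rect_diag_sum.
rewrite !(mulmx_sumr, mulmx_suml) summxE mulr_sumr; apply: eq_bigr => j _.
rewrite -!(scalemxAl, scalemxAr) mxE.
have -> : U^T *m (P *m delta_mx (lord j) (rord j) *m Q^T *m V) =
    col (lord j) (U^T *m P) *m (col (rord j) (V^T *m Q))^T.
  rewrite !colE trmx_mul trmx_delta !trmx_mul trmxK !mulmxA.
  by rewrite -(mulmxA _ (delta_mx _ 0)) mul_delta_mx.
by rewrite mxE big_ord1 !mxE /coupling ![in RHS]mxE; ring.
Qed.

(** Turns column sums into row sums, so that one bound covers both marginals. *)
Lemma coupling_sym U P V Q i j : coupling U P V Q i j = coupling P U Q V j i.
Proof.
have tr q (A B : 'M[R]_q) k l : (A^T *m B) k l = (B^T *m A) l k.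
  by rewrite -{2}[A]trmxK -trmx_mul [RHS]mxE.
by rewrite /coupling tr (tr _ V).
Qed.

(** Here [|a b| <= (a^2 + b^2) / 2], and the rows of [U^T P] and [V^T Q] have norm one. *)
Lemma coupling_row_le1 U P V Q i :
  orthogonal U -> orthogonal P -> orthogonal V -> orthogonal Q ->
  \sum_j `|coupling U P V Q i j| <= 1.
Proof.
move=> oU oP oV oQ.
have oUP := orthogonalM (orthogonal_tr oU) oP.
have oVQ := orthogonalM (orthogonal_tr oV) oQ.
have rU := orthogonal_row_le1 (lord i) lord_inj oUP.
have rV := orthogonal_row_le1 (rord i) rord_inj oVQ.
apply: (@le_trans _ _ (\sum_j ((U^T *m P) (lord i) (lord j) ^+ 2 / 2 +
    (V^T *m Q) (rord i) (rord j) ^+ 2 / 2))).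
  apply: ler_sum => j _; rewrite /coupling normrM.
  rewrite -[X in _ <= X / 2 + _]real_normK ?num_real //.
  rewrite -[X in _ <= _ + X / 2]real_normK ?num_real //.
  by rewrite -subr_ge0 (_ : _ - _ = (`|(U^T *m P) (lord i) (lord j)| -
    `|(V^T *m Q) (rord i) (rord j)|) ^+ 2 / 2);
    [rewrite divr_ge0 ?sqr_ge0 | field].
by rewrite big_split /= -!mulr_suml; lra.
Qed.

(* A doubly substochastic coupling, with the missing mass of each marginal
   paid for by the nonnegative potentials [al] and [be]. *)
Lemma coupling_transport U P V Q (w : 'I_p -> 'I_p -> R) (al be : 'I_p -> R) :
  orthogonal U -> orthogonal P -> orthogonal V -> orthogonal Q ->
  (forall i, 0 <= al i) -> (forall j, 0 <= be j) ->
  (forall i j, 0 <= w i j <= al i + be j) ->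
  \sum_i \sum_j coupling U P V Q i j * w i j <= \sum_i al i + \sum_j be j.
Proof.
move=> oU oP oV oQ al0 be0 wle; set c := coupling U P V Q.
apply: (@le_trans _ _ (\sum_i \sum_j (`|c i j| * al i + `|c i j| * be j))).
  apply: ler_sum => i _; apply: ler_sum => j _; case/andP: (wle i j) => w0 wab.
  (* As [w i j >= 0], the coupling may be replaced by its absolute value. *)
  rewrite -mulrDr; apply: (le_trans (y := `|c i j| * w i j)).
    by apply: ler_wpM2r => //; exact: ler_norm.
  exact: ler_wpM2l.
under eq_bigr => i _ do rewrite big_split /=.
rewrite big_split /= [X in _ + X]exchange_big /=; apply: lerD.
  apply: ler_sum => i _; rewrite -mulr_suml ler_piMl //.
  exact: coupling_row_le1.
apply: ler_sum => j _; rewrite -mulr_suml ler_piMl //.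
under eq_bigr => i _ do rewrite /c coupling_sym.
exact: coupling_row_le1.
Qed.

Lemma mxdot_svd_mx_le U V P Q (a b : 'rV[R]_p) (al be : 'I_p -> R) :
  orthogonal U -> orthogonal P -> orthogonal V -> orthogonal Q ->
  (forall i, 0 <= al i) -> (forall j, 0 <= be j) ->
  (forall i j, 0 <= a 0 i * b 0 j <= al i + be j) ->
  mxdot (svd_mx U V a) (svd_mx P Q b) <= \sum_i al i + \sum_j be j.
Proof. by move=> *; rewrite mxdot_svd_mx; exact: coupling_transport. Qed.

Lemma mxdot_svd_mx_diag U V a b :
  orthogonal U -> orthogonal V ->
  mxdot (svd_mx U V a) (svd_mx U V b) = \sum_l a 0 l * b 0 l.
Proof.
move=> oU oV; rewrite mxdot_svd_mx; apply: eq_bigr => i _.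
rewrite (bigD1 i) //= /coupling oU oV !mxE !eqxx mulr1n mul1r mul1r.
rewrite big1 ?addr0 // => j ji; rewrite !mxE.
by rewrite (inj_eq lord_inj) eq_sym (negPf ji) mul0r mul0r.
Qed.

Lemma svd_mx_exists (X : 'M[R]_(m, n)) :
  exists s U V, [/\ is_singular_values X s, orthogonal U, orthogonal V
    & X = svd_mx U V s].
Proof.
have [s [U [V [oU oV XE sP _]]]] := svd_exists X.
have s_mono i j : (i <= j)%N -> s j <= s i.
  elim: j => [|j IHj]; first by rewrite leqn0 => /eqP ->.
  rewrite leq_eqVlt => /predU1P[-> //|/IHj]; case/andP: (sP j) => _.
  exact: le_trans.
have s0 i : 0 <= s i by case/andP: (sP i) => s0 /(le_trans s0).
exists (\row_l s l), U, V; rewrite /svd_mx -svals_mx_rect_diag; split=> //.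
split=> [i|i j ij|]; rewrite ?mxE ?s_mono //.
by exists U, V; rewrite -svals_mx_rect_diag.
Qed.

Lemma singular_valuesP (X : 'M[R]_(m, n)) :
  is_singular_values X (singular_values X).
Proof.
have [s [U [V [Xs _ _ _]]]] := svd_mx_exists X.
by apply: (@xgetPex _ 0 [set s | is_singular_values X s]); exists s.
Qed.

End Coupling.

(** * The scalar penalty and its subdifferential *)

Section Regularizer.
Variable R : realType.

(* The scalar penalty [g] of the paper, with [q = sqrt mu]. *)
Definition gfun (q s : R) : R := q ^+ 2 - Num.max (q - `|s|) 0 ^+ 2 + s ^+ 2.

Lemma gfun_le q s : 0 <= s -> s <= q -> gfun q s = 2 * q * s.
Proof.
move=> s0 sq; rewrite /gfun ger0_norm // max_l ?subr_ge0 //; ring.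
Qed.

Lemma gfun_ge q s : 0 <= s -> q <= s -> gfun q s = q ^+ 2 + s ^+ 2.
Proof.
by move=> s0 qs; rewrite /gfun ger0_norm // max_r ?subr_le0 // expr0n subr0.
Qed.

Lemma gfun_ge_sqr q s : 0 <= q -> 0 <= s -> s ^+ 2 <= gfun q s.
Proof.
move=> q0 s0; have [sq|/ltW qs] := leP s q.
  by rewrite gfun_le //; nra.
by rewrite gfun_ge //; nra.
Qed.

(* For [w >= q], [w ^+ 2 - q ^+ 2] is the Fenchel conjugate of [g] at [2 * w]. *)
Lemma gfun_fenchel q s w :
  0 <= q -> 0 <= s -> q <= w -> s * (2 * w) <= gfun q s + (w ^+ 2 - q ^+ 2).
Proof.
move=> q0 s0 qw; have [sq|/ltW qs] := leP s q.
  by rewrite gfun_le // -subr_ge0 (_ : _ - _ = (w - q) * (w + q - 2 * s));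
    [apply: mulr_ge0; lra | ring].
rewrite gfun_ge // -subr_ge0 (_ : _ - _ = (w - s) ^+ 2); first exact: sqr_ge0.
ring.
Qed.

(** Fenchel's inequality is tight at [w = max q s], because [2 * max q s] is a subgradient of g at
    [s]. *)
Lemma gfun_fenchel_eq q s :
  0 <= s -> gfun q s + (Num.max q s ^+ 2 - q ^+ 2) = s * (2 * Num.max q s).
Proof.
by move=> s0; case: leP => [qs|/ltW sq]; [rewrite gfun_ge | rewrite gfun_le];
  rewrite //; ring.
Qed.

(* [2 z] is a subgradient of [g] at [x >= 0], with [z >= 0]. *)
Definition graph_dg (q x z : R) : Prop :=
  [\/ x = 0 /\ 0 <= z <= q, 0 <= x <= q /\ z = q | q <= x /\ z = x].

Lemma graph_dg_ge0 q x z : 0 <= q -> graph_dg q x z -> 0 <= x <= x + z.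
Proof. by move=> q0 [[-> /andP[? ?]]|[/andP[? ?] ->]|[? ->]]; lra. Qed.

Lemma graph_dg_subgradient q x z s :
  0 <= q -> graph_dg q x z -> 0 <= s ->
  0 <= gfun q s - gfun q x - 2 * z * (s - x).
Proof.
move=> q0 g s0; have [sq|/ltW qs] := leP s q.
  rewrite (gfun_le s0 sq); case: g => [[-> /andP[? ?]]|[/andP[? ?] ->]|[qx ->]].
  - by rewrite gfun_le //; nra.
  - by rewrite gfun_le //; nra.
  - by rewrite gfun_ge //; [nra | lra].
rewrite (gfun_ge s0 qs); case: g => [[-> /andP[? ?]]|[/andP[? ?] ->]|[qx ->]].
- by rewrite gfun_le //; nra.
- by rewrite gfun_le //; have := sqr_ge0 (s - q); lra.
- by rewrite gfun_ge //; [have := sqr_ge0 (s - x); lra | lra].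
Qed.

(* The part of [graph_dg] where [z] avoids the interval between [(1 - d) q] and
   [q / (1 - d)]. *)
Definition gapped (q d x z : R) : Prop :=
  (x = 0 /\ 0 <= z <= (1 - d) * q) \/ (x = z /\ q <= (1 - d) * z).

(** A plain subgradient leaves no quadratic margin, since g is affine on [[0, q]]; keeping [z] a
    factor [1 - d] away from the threshold [q] yields the margin [d * (s - x) ^+ 2]. *)
Lemma gapped_strong_subgradient q d x z s :
  0 < q -> 0 <= d < 1 -> gapped q d x z -> 0 <= s ->
  d * (s - x) ^+ 2 <= gfun q s - gfun q x - 2 * z * (s - x).
Proof.
move=> q0 /andP[d0 d1] g s0; case: g => [[-> /andP[z0 zq]]|[-> qz]].
  rewrite [gfun q 0]gfun_le ?(ltW q0) //; have [sq|/ltW qs] := leP s q.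
    rewrite gfun_le //; have : 0 <= ((1 - d) * q - z) * s by apply: mulr_ge0; lra.
    have : 0 <= d * (q - s) * s by do ?apply: mulr_ge0; lra.
    have : 0 <= d * q * s by do ?apply: mulr_ge0; lra.
    by lra.
  rewrite gfun_ge //; have : 0 <= ((1 - d) * q - z) * s by apply: mulr_ge0; lra.
  have : 0 <= (1 - d) * (s - q) ^+ 2 by apply: mulr_ge0; [lra | exact: sqr_ge0].
  have : 0 <= d * q ^+ 2 by apply: mulr_ge0; [lra | exact: sqr_ge0].
  by lra.
have qz' : q <= z by nra.
rewrite [gfun q z]gfun_ge //; last lra.
have [sq|/ltW qs] := leP s q.
  rewrite gfun_le //.
  have : 0 <= ((1 - d) * z - q) * (z - s) by apply: mulr_ge0; lra.
  have : 0 <= (z - q) * (q - s) by apply: mulr_ge0; lra.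
  have : 0 <= d * s * (z - s) by do ?apply: mulr_ge0; lra.
  by lra.
rewrite gfun_ge //; have : 0 <= (1 - d) * (s - z) ^+ 2.
  by apply: mulr_ge0; [lra | exact: sqr_ge0].
by lra.
Qed.

(** After factoring out [x' - x], the two factors agree in sign in the mixed cases; for [x = z] and
    [x' = z'] the product is [(1 - d) * (x' - z) ^+ 2]. *)
Lemma gapped_graph_mono q d x z x' z' :
  0 < q -> 0 <= d < 1 -> gapped q d x z -> graph_dg q x' z' ->
  d * (x' - x) ^+ 2 <= (z' - z) * (x' - x).
Proof.
move=> q0 /andP[d0 d1] g g'.
rewrite -subr_ge0 (_ : _ - _ = (z' - z - d * (x' - x)) * (x' - x)); last by ring.
case: g => [[-> /andP[z0 zq]]|[-> qz]];
  case: g' => [[-> /andP[z0' zq']]|[/andP[x0' xq'] ->]|[qx' ->]].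
- by rewrite subr0 mulr0.
- by apply: mulr_ge0; nra.
- by apply: mulr_ge0; nra.
- by rewrite -mulrNN; apply: mulr_ge0; nra.
- by rewrite -mulrNN; apply: mulr_ge0; nra.
- rewrite (_ : _ * _ = (1 - d) * (x' - z) ^+ 2); last by ring.
  by apply: mulr_ge0; [lra | exact: sqr_ge0].
Qed.

End Regularizer.

(** * The matrix penalty and its subdifferential *)

Section MatrixRegularizer.
Variables (R : realType) (m n : nat).
Local Notation p := (minn m n).

Lemma regG_svd (mu : R) (X : 'M[R]_(m, n)) :
  0 <= mu ->
  exists (s : 'rV[R]_p) U V,
    [/\ orthogonal U, orthogonal V, X = svd_mx U V s, forall l, 0 <= s 0 l
      & regG mu X = \sum_l gfun (Num.sqrt mu) (s 0 l)].
Proof.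
move=> mu0; have [s0 _ [U [V [oU oV XE]]]] := singular_valuesP X.
exists (singular_values X), U, V; split=> //.
rewrite /regG sqr_frob {2 3}XE -/(svd_mx U V _) mxdot_svd_mx_diag //.
rewrite /r_mu -big_split /=; apply: eq_bigr => l _.
by rewrite /gfun sqr_sqrtr // expr2.
Qed.

(* Invariance of [regG] under the choice of the decomposition (one inequality
   suffices): evaluate the conjugate of [g] at the dual optimal matrix. *)
Lemma regG_svd_mx_le (mu : R) U V (y : 'rV[R]_p) :
  0 <= mu -> orthogonal U -> orthogonal V -> (forall l, 0 <= y 0 l) ->
  regG mu (svd_mx U V y) <= \sum_l gfun (Num.sqrt mu) (y 0 l).
Proof.
move=> mu0 oU oV y0; set q := Num.sqrt mu; have q0 : 0 <= q := sqrtr_ge0 _.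
have [s [P [Q [oP oQ YE s0 ->]]]] := regG_svd (svd_mx U V y) mu0.
pose w := \row_l (2 * Num.max q (s 0 l)).
have wE : \sum_l s 0 l * w 0 l = mxdot (svd_mx U V y) (svd_mx P Q w).
  by rewrite YE mxdot_svd_mx_diag.
have : mxdot (svd_mx U V y) (svd_mx P Q w) <=
    \sum_l gfun q (y 0 l) + \sum_l (Num.max q (s 0 l) ^+ 2 - q ^+ 2).
  apply: mxdot_svd_mx_le => // [i|j|i j].
  - exact: le_trans (sqr_ge0 _) (gfun_ge_sqr q0 (y0 i)).
  - by rewrite subr_ge0 ler_pXn2r ?nnegrE ?le_max ?lexx ?q0.
  - rewrite mxE; apply/andP; split.
      by rewrite !mulr_ge0 // le_max q0.
    by apply: gfun_fenchel; rewrite // le_max lexx.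
rewrite -wE (eq_bigr (fun l => gfun q (s 0 l) +
    (Num.max q (s 0 l) ^+ 2 - q ^+ 2))) ?big_split /= ?lerD2r // => l _.
by rewrite mxE -gfun_fenchel_eq.
Qed.

(* [x] minimises [s |-> g s + t s^2 - 2 nu s] entrywise with modulus [ka], so
   the matrix minimiser has the singular vectors of [N]. *)
Lemma minimizer_svd (mu t ka : R) (X : 'M[R]_(m, n)) U V (nu x : 'rV[R]_p) :
  0 <= mu -> 0 < ka <= 1 + t -> orthogonal U -> orthogonal V ->
  (forall i, 0 <= x 0 i) -> (forall i, ka * x 0 i <= nu 0 i) ->
  (forall i s, 0 <= s -> ka * (s - x 0 i) ^+ 2 <=
     gfun (Num.sqrt mu) s + t * s ^+ 2 -
     (gfun (Num.sqrt mu) (x 0 i) + t * x 0 i ^+ 2) -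
     2 * nu 0 i * (s - x 0 i)) ->
  (forall Y, regG mu X + t * mxdot X X - 2 * mxdot (svd_mx U V nu) X <=
     regG mu Y + t * mxdot Y Y - 2 * mxdot (svd_mx U V nu) Y) ->
  X = svd_mx U V x.
Proof.
move=> mu0 /andP[ka0 kat] oU oV x0 kx ptw /(_ (svd_mx U V x)) min.
set q := Num.sqrt mu in ptw; have q0 : 0 <= q := sqrtr_ge0 _.
have [s [P [Q [oP oQ XE s0 GE]]]] := regG_svd X mu0.
have g0 : gfun q 0 = 0 by rewrite gfun_le // mulr0.
have gx := regG_svd_mx_le mu0 oU oV x0; rewrite -/q in gx GE.
(* The entrywise bound splits as [2 (nu_i - ka x_i) s_j <= al_i + be_j] with the two summands below.
   Setting [s = 0] gives [al_i >= 0]; [ka <= 1 + t] and [g s >= s^2] give [be_j >= 0]. *)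
have : mxdot (svd_mx U V (2 *: (nu - ka *: x))) (svd_mx P Q s) <=
    \sum_i (2 * (nu 0 i * x 0 i) - gfun q (x 0 i) - t * (x 0 i * x 0 i)
             - ka * (x 0 i * x 0 i)) +
    \sum_j (gfun q (s 0 j) + t * (s 0 j * s 0 j) - ka * (s 0 j * s 0 j)).
  apply: mxdot_svd_mx_le => // [i|j|i j].
  - by have := ptw i 0 (lexx _); rewrite g0; lra.
  - have := gfun_ge_sqr q0 (s0 j).
    have : 0 <= (1 + t - ka) * s 0 j ^+ 2.
      by apply: mulr_ge0; [lra | exact: sqr_ge0].
    by lra.
  - rewrite !mxE; apply/andP; split.
      by rewrite !mulr_ge0 // subr_ge0.
    by have := ptw i _ (s0 j); lra.
rewrite -XE svd_mxZ svd_mxD -scaleN1r scalerA svd_mxZ.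
rewrite mxdotZl mxdotDl mxdotZl => up.
apply/subr0_eq/mxdot_eq0/eqP; rewrite eq_le mxdot_ge0 andbT.
(* Combined with the minimality of [X] against [svd_mx U V x], the bound leaves
   [ka |X - svd_mx U V x|^2 <= 0]. *)
rewrite -(pmulr_rle0 _ ka0).
have XX : mxdot X X = \sum_j s 0 j * s 0 j by rewrite XE mxdot_svd_mx_diag.
have SS : mxdot (svd_mx U V x) (svd_mx U V x) = \sum_i x 0 i * x 0 i.
  by rewrite mxdot_svd_mx_diag.
have NS : mxdot (svd_mx U V nu) (svd_mx U V x) = \sum_i nu 0 i * x 0 i.
  by rewrite mxdot_svd_mx_diag.
move: up GE gx; move: (gfun q) => g + GE gx.
rewrite !(sumrB, big_split) /= -!mulr_sumr -XX -SS -NS -GE.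
rewrite mxdotBl !mxdotBr (mxdotC X (svd_mx _ _ _)).
by lra.
Qed.

(** Off the gap, [z] determines [x] by hard thresholding, and [minimizer_svd] applies with [t = 0]
    and modulus [ka = d]. Hence any decomposition of the dual matrix also diagonalises [X]. *)
Lemma subdifferential_gapped_svd (mu d : R) (X : 'M[R]_(m, n)) U V
    (z : 'rV[R]_p) :
  0 < mu -> 0 < d < 1 -> orthogonal U -> orthogonal V ->
  (forall i, 0 <= z 0 i) ->
  (forall i, z 0 i <= (1 - d) * Num.sqrt mu \/
             Num.sqrt mu <= (1 - d) * z 0 i) ->
  subdifferential (@regG R mu m n) X (2 *: svd_mx U V z) ->
  exists2 x : 'rV[R]_p, X = svd_mx U V x &
    forall i, gapped (Num.sqrt mu) d (x 0 i) (z 0 i).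
Proof.
move=> mu0 /andP[d0 d1] oU oV z0 gap sub; set q := Num.sqrt mu.
have q0 : 0 < q by rewrite sqrtr_gt0.
pose x := \row_i (if z 0 i <= (1 - d) * q then 0 else z 0 i).
have xz i : gapped q d (x 0 i) (z 0 i).
  rewrite mxE; case: ifP => zq; first by left; rewrite z0.
  by right; split=> //; case: (gap i) => //; rewrite -/q zq.
exists x => //; apply: (@minimizer_svd mu 0 d) => //.
- exact: ltW.
- by rewrite d0 addr0 ltW.
- by move=> i; rewrite mxE; case: ifP.
- by move=> i; case: (xz i) => [[-> _]|[-> _]]; [rewrite mulr0 | have := z0 i; nra].
- move=> i s s0; have := @gapped_strong_subgradient _ q d _ _ s q0 _ (xz i) s0.
  by rewrite (ltW d0) d1 -/q => /(_ erefl); lra.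
- move=> Y; have := sub Y; rewrite mxdotZl mxdotBr; lra.
Qed.

(* [X] minimises the strongly convex [G + |.|^2 - 2 <X + Z, .>], so a singular
   value decomposition of [X + Z] diagonalises both [X] and [Z]. *)
Lemma subdifferential_svd (mu : R) (X Z : 'M[R]_(m, n)) :
  0 < mu -> subdifferential (@regG R mu m n) X (2 *: Z) ->
  exists U V (x z : 'rV[R]_p),
    [/\ orthogonal U, orthogonal V, X = svd_mx U V x, Z = svd_mx U V z
      & forall i, graph_dg (Num.sqrt mu) (x 0 i) (z 0 i)].
Proof.
move=> mu0 sub; set q := Num.sqrt mu; have q0 : 0 < q by rewrite sqrtr_gt0.
have [nu [U [V [[nu0 _ _] oU oV NE]]]] := svd_mx_exists (X + Z).
(* [f] recovers [x] from [y = x + z] along [graph_dg]: it is the resolvent of half the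
   subdifferential of g. *)
pose f y : R := if y <= q then 0 else if y <= 2 * q then y - q else y / 2.
pose x := \row_i f (nu 0 i).
have xz i : graph_dg q (x 0 i) (nu 0 i - x 0 i).
  rewrite mxE /f; move: (nu 0 i) (nu0 i) => y y0; case: leP => [yq|/ltW qy].
    by constructor 1; rewrite subr0 y0 yq.
  case: leP => [yq|/ltW q2y]; first by constructor 2; split; lra.
  by constructor 3; split; lra.
have XE : X = svd_mx U V x.
  apply: (@minimizer_svd mu 1 1 X U V nu) => //.
  - exact: ltW.
  - by lra.
  - by move=> i; case/andP: (graph_dg_ge0 (ltW q0) (xz i)).
  - move=> i; case/andP: (graph_dg_ge0 (ltW q0) (xz i)) => _.
    by rewrite mul1r addrC subrK.
  - move=> i s s0.
    by have := graph_dg_subgradient (ltW q0) (xz i) s0; rewrite -/q; lra.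
  (* Adding [|Y - X|^2 >= 0] to the subgradient inequality gives minimality. *)
  - move=> Y; rewrite -NE; have := sub Y; have := mxdot_ge0 (Y - X).
    rewrite mxdotZl !(mxdotBr, mxdotBl, mxdotDl) (mxdotC Y X); lra.
exists U, V, x, (nu - x); split=> // [|i]; last first.
  by have := xz i; rewrite [(nu - x) 0 i]mxE [(- x) 0 i]mxE.
by rewrite svd_mxD -NE -scaleN1r svd_mxZ -XE scaleN1r addrAC subrr add0r.
Qed.

(** On expansion, products within one decomposition become diagonal sums, while the cross terms form
    a coupled sum that is bounded by transporting [gapped_graph_mono]. *)
Lemma svd_gapped_mono (q d : R) U V P Q (x z x' z' : 'rV[R]_p) :
  0 < q -> 0 <= d < 1 ->
  orthogonal U -> orthogonal V -> orthogonal P -> orthogonal Q ->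
  (forall i, gapped q d (x 0 i) (z 0 i)) -> (forall i, 0 <= z 0 i) ->
  (forall j, graph_dg q (x' 0 j) (z' 0 j)) ->
  d * mxdot (svd_mx P Q x' - svd_mx U V x) (svd_mx P Q x' - svd_mx U V x) <=
  mxdot (svd_mx P Q z' - svd_mx U V z) (svd_mx P Q x' - svd_mx U V x).
Proof.
move=> q0 /andP[d0 d1] oU oV oP oQ xz z0 xz'.
have x0 i : 0 <= x 0 i by case: (xz i) => [[-> _]|[-> _]].
have xlez i : x 0 i <= z 0 i by case: (xz i) => [[-> _]|[-> _]].
have x0' j : 0 <= x' 0 j by case/andP: (graph_dg_ge0 (ltW q0) (xz' j)).
have mono i j := gapped_graph_mono q0 (introT andP (conj d0 d1)) (xz i) (xz' j).
have CE : mxdot (svd_mx U V z) (svd_mx P Q x') +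
    mxdot (svd_mx U V x) (svd_mx P Q z') -
    2 * d * mxdot (svd_mx U V x) (svd_mx P Q x') =
    \sum_i \sum_j coupling U P V Q i j *
      (z 0 i * x' 0 j + x 0 i * z' 0 j - 2 * d * (x 0 i * x' 0 j)).
  rewrite !mxdot_svd_mx mulr_sumr -big_split -sumrB; apply: eq_bigr => i _.
  rewrite /= mulr_sumr -big_split -sumrB; apply: eq_bigr => j _ /=; ring.
have : \sum_i \sum_j coupling U P V Q i j *
      (z 0 i * x' 0 j + x 0 i * z' 0 j - 2 * d * (x 0 i * x' 0 j)) <=
    \sum_i (z 0 i * x 0 i - d * (x 0 i * x 0 i)) +
    \sum_j (z' 0 j * x' 0 j - d * (x' 0 j * x' 0 j)).
  apply: coupling_transport => // [i|j|i j].
  - have : 0 <= (z 0 i - x 0 i) * x 0 i by rewrite mulr_ge0 // subr_ge0.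
    have : 0 <= (1 - d) * x 0 i * x 0 i by rewrite !mulr_ge0 //; lra.
    lra.
  - have : 0 <= (1 - d) * x' 0 j * x' 0 j by rewrite !mulr_ge0 //; lra.
    have : 0 <= (z' 0 j - x' 0 j) * x' 0 j.
      case: (xz' j) => [[-> _]|[/andP[? ?] ->]|[_ ->]]; rewrite ?mulr0 //.
        by rewrite mulr_ge0 // subr_ge0.
      by rewrite subrr mul0r.
    lra.
  (* The weight equals [(z_i - x_i) x'_j + (z'_j - x'_j) x_i + 2 (1 - d) x_i x'_j], hence is
     nonnegative; the upper bound is [gapped_graph_mono] expanded. *)
  - apply/andP; split; last by have := mono i j; lra.
    have : 0 <= (z 0 i - x 0 i) * x' 0 j by rewrite mulr_ge0 // subr_ge0.
    have : 0 <= (z' 0 j - x' 0 j) * x 0 i.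
      rewrite mulr_ge0 // subr_ge0.
      by case: (xz' j) => [[-> /andP[]]|[/andP[? ?] ->]|[_ ->]].
    have : 0 <= (1 - d) * x 0 i * x' 0 j by rewrite !mulr_ge0 //; lra.
    lra.
have DU a b := mxdot_svd_mx_diag a b oU oV.
have DP a b := mxdot_svd_mx_diag a b oP oQ.
rewrite -CE !sumrB -!mulr_sumr -(DU z x) -(DU x x) -(DP z' x') -(DP x' x').
rewrite !(mxdotBr, mxdotBl).
rewrite (mxdotC (svd_mx P Q x') (svd_mx U V x)).
rewrite (mxdotC (svd_mx P Q z') (svd_mx U V x)).
lra.
Qed.

End MatrixRegularizer.

(** * Enlarging the gap, and the rank bound *)

(** Finitely many strict inequalities have a common slack, so [d] can be enlarged; the excess
    [d' - d] makes the final comparison strict. *)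
Lemma strict_gap (R : realType) p (q d : R) (z : 'I_p -> R) :
  0 < q -> d < 1 -> (forall i, 0 <= z i) ->
  (forall i, z i \notin `[(1 - d) * q, q / (1 - d)]) ->
  exists2 d', d < d' < 1 &
    forall i, z i <= (1 - d') * q \/ q <= (1 - d') * z i.
Proof.
move=> q0 d1 z0 gap; have d10 : 0 < 1 - d by lra.
(* [e i] is the largest constant that keeps [z i] on its side of the gap; the default [(1 + d) / 2]
   of the minimum keeps [d'] below one. *)
pose e i := if z i < (1 - d) * q then 1 - z i / q else 1 - q / z i.
pose d' := \big[Num.min/((1 + d) / 2)]_i e i.
have le_e i : d' <= e i by exact: bigmin_le.
have zq i : (1 - d) * q <= z i -> q < (1 - d) * z i.
  move=> zi; have := gap i; rewrite in_itv /= zi /= -ltNge.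
  by rewrite ltr_pdivrMr // mulrC.
exists d'.
  apply/andP; split; last first.
    by apply: (@le_lt_trans _ _ ((1 + d) / 2)); [exact: bigmin_le_id | lra].
  apply: lt_bigmin => [|i _]; first by lra.
  rewrite /e; case: (ltP (z i)) => zi.
    by rewrite ltrBrDl -ltrBrDr ltr_pdivrMr.
  have zi0 : 0 < z i by apply: lt_le_trans zi; exact: mulr_gt0.
  by rewrite ltrBrDl -ltrBrDr ltr_pdivrMr // zq.
move=> i; have := le_e i; rewrite /e; case: (ltP (z i)) => zi de; [left|right].
  by rewrite -ler_pdivrMr //; lra.
have zi0 : 0 < z i by apply: lt_le_trans zi; exact: mulr_gt0.
by rewrite -ler_pdivrMr //; lra.
Qed.

Lemma statZ_sub (R : realType) m n k (A : {linear 'M[R]_(m, n) -> 'cV[R]_k})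
    (b : 'cV[R]_k) (X Y : 'M[R]_(m, n)) :
  mxdot (statZ A b X - statZ A b Y) (X - Y) =
  mxdot (X - Y) (X - Y) - mxdot (A (X - Y)) (A (X - Y)).
Proof.
rewrite adjointP (mxdotC (X - Y) (adjoint _ _)) -mxdotBl.
congr mxdot.
have -> : adjoint A (A (X - Y)) = adjoint A (A X) - adjoint A (A Y).
  by apply/matrixP => i j; rewrite !mxE linearB mxdotBr.
by rewrite /statZ opprD addrACA subrr addr0 opprD addrACA -opprD.
Qed.

Theorem theorem4p3 (R : realType) (m n k : nat)
  (A : {linear 'M[R]_(m, n) -> 'cV[R]_k}) (b : 'cV[R]_k) (mu : R)
  (r : nat) (delta : R) (Xs : 'M[R]_(m, n)) :
  0 < mu ->
  (0 < r)%N ->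
  0 <= delta -> delta < 1 ->
  rank_RIP A r delta ->
  stationary A b mu Xs ->
  (forall i : 'I_(minn m n),
    singular_values (statZ A b Xs) 0 i \notin
      `[(1 - delta) * Num.sqrt mu, Num.sqrt mu / (1 - delta)]) ->
  forall Xs' : 'M[R]_(m, n),
    Xs' != Xs -> stationary A b mu Xs' -> (r < \rank (Xs' - Xs)%R)%N.
Proof.
move=> mu0 _ d0 d1 RIP Xs_stat gap Xs' neq Xs'_stat.
rewrite ltnNge; apply: contra neq => /RIP/andP[lower _].
have q0 : 0 < Num.sqrt mu by rewrite sqrtr_gt0.
have [z0 _ [U [V [oU oV ZE]]]] := singular_valuesP (statZ A b Xs).
have [d /andP[dd d'1] gap'] := strict_gap q0 d1 z0 gap.
move: Xs_stat; rewrite /stationary {1}ZE.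
case/(subdifferential_gapped_svd mu0 _ oU oV z0 gap') => [|x XE xz].
  by rewrite d'1 (le_lt_trans d0).
have [P [Q [x' [z' [oP oQ XE' ZE' xz']]]]] := subdifferential_svd mu0 Xs'_stat.
have := svd_gapped_mono q0 _ oU oV oP oQ xz z0 xz'.
rewrite -XE -XE' -ZE' /svd_mx -ZE statZ_sub d'1 (le_trans d0 (ltW dd)).
move=> /(_ erefl); move: lower; rewrite !sqr_frob => lower upper.
apply/eqP/subr0_eq/mxdot_eq0/eqP; rewrite eq_le mxdot_ge0 andbT.
(* With [H = Xs' - Xs], [lower] and [upper] combine to [(d - delta) |H|^2 <= 0], where
   [d > delta]. *)
by rewrite -(@pmulr_rle0 _ (d - delta)); lra.
Qed.
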